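(* For any integer $n\geqslant 0$, $$\sum_{k=0}^{n}q^{k-1}b_k(q)\,b_{n-k}(q)=-[n-1]_q\,b_n(q)-[n-2]_q\,b_{n-1}(q),$$ where $b_k(q)=0$ for $k<0$.
   Context: Let $q$ be an indeterminate. For any integer $n$ (possibly negative or zero), let $[n]_q=\frac{1-q^{n}}{1-q}$ (so e.g. $[-1]_q=-q^{-1}$, $[0]_q=0$, $[1]_q=1$). Define the $q$-logarithm as the (formal) power series $\log_q(1+t)=\sum_{n=1}^{\infty}\frac{(-1)^{n-1}t^n}{[n]_q}$. The $q$-Bernoulli numbers of the second kind $b_n(q)$ are defined by $\sum_{n=0}^\infty b_n(q)t^n=\frac{t}{\log_q(1+t)}$, and one sets $b_k(q)=0$ for $k<0$. *)

(* Defs.v *)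
From mathcomp Require Import all_boot all_order all_algebra.

Set Implicit Arguments.
Unset Strict Implicit.
Unset Printing Implicit Defensive.

Import GRing.Theory.
Local Open Scope ring_scope.

Definition Qq : fieldType := {fraction {poly rat}}.
Definition q : Qq := tofrac 'X.

Definition qint (n : int) : Qq := (1 - q ^ n) / (1 - q).

(* A formal power series \sum_n f_n t^n is represented by its coefficient
   sequence n |-> f_n. *)
Definition series (F : fieldType) := nat -> F.

Definition smul (F : fieldType) (f g : series F) : series F :=
  fun n => \sum_(i < n.+1) f i * g (n - i)%N.

Definition sX (F : fieldType) : series F := fun n => (n == 1%N)%:R.

(* (\sum_n f_n t^n) / t, when f_0 = 0. *)
Definition sshift (F : fieldType) (f : series F) : series F := fun n => f n.+1.

(* The first n coefficients of the inverse g of f, by the recurrence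
   g_0 = f_0^-1 and g_m = - f_0^-1 * \sum_(i < m) g_i f_(m - i). *)
Fixpoint sinv_coefs (F : fieldType) (f : series F) (n : nat) : seq F :=
  if n is m.+1 then
    let s := sinv_coefs f m in
    rcons s (if m == 0%N then (f 0%N)^-1
             else - (f 0%N)^-1 * \sum_(i < m) s`_i * f (m - i)%N)
  else [::].

Definition sinv (F : fieldType) (f : series F) : series F :=
  fun n => (sinv_coefs f n.+1)`_n.

Definition qlog1p : series Qq :=
  fun n => if n is m.+1 then (-1) ^+ m / qint n%:Z else 0.

(* t / log_q(1 + t), where log_q(1 + t) is qlog1p: its constant term is 0, so
   the quotient is the inverse of log_q(1 + t) / t, whose constant term is 1.
   The lemmas qbern2_seriesP and qbern2_series_uniq below show that this is
   the only series B such that B * log_q(1 + t) = t. *)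
Definition qbern2_series : series Qq := sinv (sshift qlog1p).

Definition qbern2 (k : int) : Qq :=
  if k is Posz n then qbern2_series n else 0.

Lemma size_sinv_coefs (F : fieldType) (f : series F) n :
  size (sinv_coefs f n) = n.
Proof. by elim: n => //= n IHn; rewrite size_rcons IHn. Qed.

Lemma nth_sinv_coefs (F : fieldType) (f : series F) n i :
  (i < n)%N -> (sinv_coefs f n)`_i = sinv f i.
Proof.
elim: n => // n IHn; rewrite ltnS leq_eqVlt => /predU1P[-> //|lt_in].
by rewrite [sinv_coefs _ _]/= nth_rcons size_sinv_coefs lt_in IHn.
Qed.

Lemma sinvP (F : fieldType) (f : series F) :
  f 0%N != 0 -> smul (sinv f) f =1 fun n => (n == 0%N)%:R.
Proof.
move=> f0 n; rewrite /smul big_ord_recr /= subnn.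
rewrite {2}/sinv /= nth_rcons size_sinv_coefs ltnn eqxx.
case: n => [|n] /=; first by rewrite big_ord0 add0r mulVf.
rewrite mulrAC mulNr mulVf // mulN1r; apply/eqP; rewrite subr_eq0; apply/eqP.
apply: eq_bigr => i _; congr (_ * _).
by rewrite -[rcons _ _]/(sinv_coefs f n.+1) nth_sinv_coefs.
Qed.

Lemma qint1 : qint 1 = 1.
Proof.
rewrite /qint expr1z divff // subr_eq0 eq_sym /q -tofrac1 tofrac_eq.
by apply/eqP => /(congr1 (horner^~ 0)); rewrite hornerX hornerC => /eqP;
  rewrite eq_sym oner_eq0.
Qed.

Lemma qlog1p1 : qlog1p 1 = 1.
Proof. by rewrite /= expr0 qint1 divr1. Qed.

Lemma qbern2_seriesP : smul qbern2_series qlog1p =1 @sX Qq.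
Proof.
case=> [|n]; first by rewrite /smul big_ord1 mulr0.
rewrite /smul big_ord_recr /= subnn mulr0 addr0 /sX eqSS.
rewrite -(@sinvP _ (sshift qlog1p)); last by rewrite /sshift qlog1p1 oner_neq0.
by apply: eq_bigr => i _; rewrite /sshift subSn // -ltnS.
Qed.

Lemma qbern2_series_uniq (B : series Qq) :
  smul B qlog1p =1 @sX Qq -> B =1 qbern2_series.
Proof.
move=> BP n; have [m] := ubnP n; elim: m n => // m IHm n; rewrite ltnS => le_nm.
have := BP n.+1; rewrite -qbern2_seriesP /smul.
rewrite !(big_ord_recr n.+1) !(big_ord_recr n) /= subnn !mulr0 !addr0.
rewrite subSnn qlog1p1 !mulr1.
rewrite (eq_bigr (fun i : 'I_n => qbern2_series i * qlog1p (n.+1 - i)%N)).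
  exact: addrI.
by move=> i _; rewrite IHm // (leq_trans _ le_nm).
Qed.

(* Main.v *)
Require Import Defs.
From mathcomp Require Import all_boot all_order all_algebra.
From mathcomp Require Import ring.

Import GRing.Theory.
Local Open Scope ring_scope.

(** Let S(t) = log_q(1 + t) / t and B(t) = 1 / S(t). The q-derivative of
    log_q(1 + t) is 1 / (1 + t), that is
      q S(qt) = S(t) + (q - 1) / (1 + t).
    Multiplying by (1 + t) B(t) B(qt) gives
      (1 + t) (q B(t) - B(qt)) = (q - 1) B(t) B(qt),
    and the theorem compares the coefficients of t^n, divided by q (q - 1).
    Power series are truncated to polynomials modulo X^N. *)

(** An explicit multiple of ['X^N] turns congruences into equations that [ring] can combine. *)
Lemma eq_mod_Xn (R : nzRingType) (N : nat) (p r : {poly R}) :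
  (forall i, (i < N)%N -> p`_i = r`_i) -> exists u, p = r + u * 'X^N.
Proof.
move=> pr; exists (drop_poly N (p - r)).
rewrite -[LHS](subrK r) -{1}(poly_take_drop N (p - r)) [RHS]addrC.
congr (_ + _); rewrite -[RHS]add0r; congr (_ + _).
apply/polyP=> i; rewrite coef_take_poly coef0 coefB.
by case: ifP => // /pr ->; rewrite subrr.
Qed.

Lemma coefM_trunc (F : fieldType) (f g : series F) (N i : nat) : (i < N)%N ->
  ((\poly_(j < N) f j) * (\poly_(j < N) g j))`_i = smul f g i.
Proof.
move=> ltiN; rewrite coefM; apply: eq_bigr => j _; rewrite !coef_poly.
have leji : (j <= i)%N by rewrite -ltnS.
by rewrite (leq_ltn_trans leji) // (leq_ltn_trans (leq_subr j i)).
Qed.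

Lemma smul_dilate (F : fieldType) (x : F) (f g : series F) (n : nat) :
  smul (fun i => x ^+ i * f i) (fun i => x ^+ i * g i) n = x ^+ n * smul f g n.
Proof.
rewrite /smul mulr_sumr; apply: eq_bigr => i _.
have lein : (i <= n)%N by rewrite -ltnS.
by rewrite mulrACA -exprD subnKC.
Qed.

(** Coefficient of t^n in (x - 1) B(xt) B(t) = (1 + t) (x B(t) - B(xt)); the second hypothesis is x
    S(xt) = S(t) + (x - 1) / (1 + t). *)
Lemma smul_dilate_inv (F : fieldType) (x : F) (b s : series F) (n : nat) :
  smul b s =1 (fun i => (i == 0%N)%:R) ->
  (forall i, x * (x ^+ i * s i) = s i + (x - 1) * (-1) ^+ i) ->
  (x - 1) * smul (fun i => x ^+ i * b i) b n
  = (x - x ^+ n) * b n + (if n is m.+1 then (x - x ^+ m) * b m else 0).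
Proof.
(* Truncation at n + 1 keeps the coefficient of t^n. Below, [c] is B(xt), [a] is S(xt) and [e] is 1
   / (1 + t). *)
move=> bs qs; pose N := n.+1; pose tr (f : series F) := \poly_(i < N) f i.
pose c : series F := fun i => x ^+ i * b i.
pose a : series F := fun i => x ^+ i * s i.
pose e : series F := fun i => (-1) ^+ i.
have [u Eu] : exists u, tr b * tr s = 1 + u * 'X^N.
  by apply: eq_mod_Xn => i ltiN; rewrite coefM_trunc // bs coef1.
have [v Ev] : exists v, tr c * tr a = 1 + v * 'X^N.
  apply: eq_mod_Xn => i ltiN; rewrite coefM_trunc // smul_dilate bs coef1.
  by case: i ltiN => [|i] _; rewrite ?mulr0 ?mulr1.
have [w Ew] : exists w, (1 + 'X) * tr e = 1 + w * 'X^N.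
  apply: eq_mod_Xn => i ltiN; rewrite mulrDl mul1r coefD coefXM !coef_poly.
  rewrite ltiN coef1; case: i ltiN => [|i] ltiN /=; first by rewrite addr0.
  by rewrite ltnW // /e exprS mulN1r addNr.
have Ea : x%:P * tr a = tr s + (x%:P - 1) * tr e.
  apply/polyP=> i; rewrite -[1]/(1%:P) -polyCB coefD !coefCM !coef_poly.
  by case: ifP => _; rewrite ?mulr0 ?addr0 ?qs.
have [r Er] : exists r, (x%:P - 1) * (tr c * tr b)
    = (1 + 'X) * (x%:P * tr b - tr c) + r * 'X^N.
  (* Multiplying [Ea] by [(1 + 'X) * tr c * tr b] produces the products in [Ev], [Eu] and [Ew]; the
     witness collects their error terms. *)
  exists ((1 + 'X) * (x%:P * tr b * v - tr c * u)
          - (x%:P - 1) * tr c * tr b * w).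
  have -> : ((1 + 'X) * (x%:P * tr b * v - tr c * u)
          - (x%:P - 1) * tr c * tr b * w) * 'X^N
    = (1 + 'X) * (x%:P * tr b * (v * 'X^N) - tr c * (u * 'X^N))
      - (x%:P - 1) * tr c * tr b * (w * 'X^N) by ring.
  have -> : v * 'X^N = tr c * tr a - 1 by rewrite Ev addrC addKr.
  have -> : u * 'X^N = tr b * tr s - 1 by rewrite Eu addrC addKr.
  have -> : w * 'X^N = (1 + 'X) * tr e - 1 by rewrite Ew addrC addKr.
  have -> : tr s = x%:P * tr a - (x%:P - 1) * tr e by rewrite Ea addrK.
  by ring.
have := congr1 (fun p : {poly F} => p`_n) Er.
rewrite -[X in x%:P - X]/(1%:P) -polyCB coefCM coefM_trunc // => ->.
rewrite coefD coefMXn ltnSn addr0 mulrDl mul1r coefD coefXM !coefB !coefCM.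
rewrite !coef_poly ltnSn /c /N.
case: (n) => [|m] /=; first by rewrite !addr0 mulrBl.
by rewrite ltnS leqnSn !mulrBl.
Qed.

Lemma q_neq0 : q != 0.
Proof. by rewrite tofrac_eq0 polyX_eq0. Qed.

Lemma qX_neq1 (n : nat) : 1 - q ^+ n.+1 != 0.
Proof.
rewrite subr_eq0 eq_sym -tofracXn -tofrac1 tofrac_eq.
by apply/eqP=> /(congr1 (size : {poly rat} -> nat)); rewrite size_polyXn size_poly1.
Qed.

(* Rational identities are proved over an abstract field: on the concrete [Qq],
   [field] unfolds the field operations and diverges. *)
Lemma qlog1p_dilate (n : nat) :
  q * (q ^+ n * sshift qlog1p n) = sshift qlog1p n + (q - 1) * (-1) ^+ n.
Proof.
have dilate (F : fieldType) (x y z : F) : 1 - x != 0 -> 1 - y != 0 ->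
    y * (z / ((1 - y) / (1 - x))) = z / ((1 - y) / (1 - x)) + (x - 1) * z.
  by move=> x1 y1; field; rewrite x1 y1.
rewrite /sshift /= /qint -exprnP mulrA -exprS.
by apply: dilate; [exact: (qX_neq1 0)|exact: qX_neq1].
Qed.

Lemma qintB (m j : nat) :
  qint (m%:Z - j%:Z) = (1 - q ^+ m / q ^+ j) / (1 - q).
Proof. by rewrite /qint expfzDr ?q_neq0 // exprnN. Qed.

Theorem theorem2 (n : nat) :
  \sum_(k < n.+1) q ^ (k%:Z - 1) * qbern2 k%:Z * qbern2 (n%:Z - k%:Z)
  = - qint (n%:Z - 1) * qbern2 n%:Z - qint (n%:Z - 2) * qbern2 (n%:Z - 1).
Proof.
(* Division by x (x - 1), used with x = q, y = q^n and z = q^n / q. *)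
have divide (F : fieldType) (x y z b c d : F) : x != 0 -> 1 - x != 0 ->
    (x - 1) * b = (x - y) * c + (x - z) * d ->
    x^-1 * b = - ((1 - y / x) / (1 - x)) * c - ((1 - z / x) / (1 - x)) * d.
  move=> x0 x1 E; have x1' : x - 1 != 0 by rewrite -opprB oppr_eq0.
  by apply: (mulfI x1'); rewrite mulrCA E; field; rewrite x0 x1.
have s0 : sshift qlog1p 0 != 0 by rewrite /sshift qlog1p1 oner_neq0.
have := smul_dilate_inv _ q _ _ n (sinvP s0) qlog1p_dilate.
rewrite -/qbern2_series => E.
have -> : \sum_(k < n.+1) q ^ (k%:Z - 1) * qbern2 k%:Z * qbern2 (n%:Z - k%:Z)
    = q^-1 * smul (fun i => q ^+ i * qbern2_series i) qbern2_series n.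
  rewrite /smul mulr_sumr; apply: eq_bigr => k _.
  rewrite subzn -1?ltnS // expfzDr ?q_neq0 // -exprnP exprN1.
  by rewrite (mulrC _ q^-1) !mulrA.
rewrite (qintB n 1%N) (qintB n 2%N) expr1.
rewrite [q ^+ 2]expr2 invfM mulrA.
apply: divide; [exact: q_neq0|exact: (qX_neq1 0)|rewrite E; congr (_ + _)].
(* For n = 0 both sides vanish because b_(-1) = 0; otherwise q^n / q = q^m. *)
case: n {E} => [|m]; first by rewrite mulr0.
by rewrite subzn // subn1 exprSr mulfK ?q_neq0.
Qed.
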